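(* Let $T$ be a tree of order $n\geq 4$ that has a quasi-star vertex $y$. Then $$w_2(T)=w_2(T_y^{-1})+w_2(T_y^{-2}).$$ Moreover, $w_2(K_{1,r})=1$ for every $r\geq 1$.
   Context: For a graph $G$, $w_2(G)$ denotes the number of unordered partitions of $V(G)$ into two nonempty dominating sets (a dominating set $S$ being one such that every vertex outside $S$ has a neighbor in $S$); equivalently, the number of weak 2-colorings of $G$ (assignments of one of two colors to each vertex so that every non-isolated vertex has a neighbor of a different color) counted up to interchanging the two colors. In a tree $T$, a leaf is a vertex of degree 1 and a support vertex is a vertex adjacent to a leaf. For a support vertex $u$, $ones(u)$ is the set of leaves adjacent to $u$; $T_u^{-1}$ is the tree obtained from $T$ by deleting the vertices of $ones(u)$, and $T_u^{-2}$ is the tree obtained from $T$ by deleting the vertices of $ones(u)\cup\{u\}$. A vertex $v$ of a tree is a quasi-star vertex if $v$ is adjacent to exactly one non-leaf vertex and to at least one leaf. *)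

(* Defs.v *)
From mathcomp Require Import all_boot.

Set Implicit Arguments.
Unset Strict Implicit.
Unset Printing Implicit Defensive.

Record sgraph := SGraph {
  vertex :> finType;
  adj : rel vertex;
  adj_sym : symmetric adj;
  adj_irr : irreflexive adj
}.

Section Graph.
Variable G : sgraph.
Implicit Types (u v : G) (S : {set G}) (P : {set {set G}}).

(* A closed walk without repeated vertices is a cycle of G only from length 3
   on: both ends of an edge form a [ucycle] of size 2. *)
Definition acyclic : Prop :=
  forall c : seq G, 2 < size c -> ~~ ucycleb (@adj G) c.

Definition connected : Prop := forall u v, connect (@adj G) u v.

Definition tree : Prop := [/\ 0 < #|G|, connected & acyclic].

Definition degree u : nat := #|[set v | adj u v]|.

Definition leaf u : bool := degree u == 1.

Definition ones u : {set G} := [set v | adj u v && leaf v].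

Definition quasi_star u : bool :=
  (#|[set v | adj u v && ~~ leaf v]| == 1) && [exists v, adj u v && leaf v].

Definition dominating S : bool :=
  [forall v, (v \notin S) ==> [exists u in S, adj v u]].

(* The blocks of a [partition] are nonempty, and P is a set of blocks, so the
   two dominating sets are unordered. *)
Definition w2 : nat :=
  #|[set P | [&& partition P [set: G], #|P| == 2
               & [forall S in P, dominating S]]]|.

End Graph.

Section Delete.
Variables (G : sgraph) (D : {set G}).

Definition delete_vertex : finType := {v : G | v \notin D}.

Definition delete_adj : rel delete_vertex := fun u v => adj (val u) (val v).

Lemma delete_adj_sym : symmetric delete_adj.
Proof. by move=> u v; apply: adj_sym. Qed.

Lemma delete_adj_irr : irreflexive delete_adj.
Proof. by move=> u; apply: adj_irr. Qed.

Definition delete : sgraph := SGraph delete_adj_sym delete_adj_irr.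

End Delete.

Definition del1 (G : sgraph) (u : G) : sgraph := delete (ones u).

Definition del2 (G : sgraph) (u : G) : sgraph := delete (ones u :|: [set u]).

Section CompleteBipartite.
Variables m n : nat.

Definition Kmn_adj : rel ('I_m + 'I_n)%type := fun u v =>
  match u, v with
  | inl _, inr _ | inr _, inl _ => true
  | _, _ => false
  end.

Lemma Kmn_adj_sym : symmetric Kmn_adj.
Proof. by case=> i [] j. Qed.

Lemma Kmn_adj_irr : irreflexive Kmn_adj.
Proof. by case. Qed.

Definition complete_bipartite : sgraph := SGraph Kmn_adj_sym Kmn_adj_irr.

End CompleteBipartite.

(* Main.v *)
(** Rooting the bipartitions at a vertex [r] turns [w2] into the number of
    weakly 2-coloured sets containing [r].  Let [z] be the non-leaf neighbour
    of [y] and root everything at [z].  The leaves at [y] are always coloured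
    opposite to [y].  If [z] and [y] differ, then [z] and [y] serve each other,
    so the colouring is determined by an arbitrary one of [del1 y], where [y]
    is a leaf at [z].  If [z] and [y] agree, then [y] is useless for [z], so the
    colouring is determined by an arbitrary one of [del2 y]. *)
Require Import Defs.
From mathcomp Require Import all_boot.

Set Implicit Arguments.
Unset Strict Implicit.
Unset Printing Implicit Defensive.

(** A colouring is encoded by one colour class. Isolated vertices are not exempt: such a vertex lies
    in only one of [S] and [~: S], and the other fails to dominate it. *)
Definition weak_coloring (G : sgraph) (S : {set G}) : bool :=
  [forall v, exists u, adj v u && ((u \in S) != (v \in S))].

Lemma weak_coloringP (G : sgraph) (S : {set G}) :
  reflect (forall v, exists2 u, adj v u & (u \in S) != (v \in S))
          (weak_coloring S).
Proof.
apply: (iffP forallP) => H v.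
  by have /existsP[u /andP[]] := H v; exists u.
by apply/existsP; have [u vu uS] := H v; exists u; rewrite vu.
Qed.

(** Domination by [S] serves the vertices outside [S], domination by [~: S] those inside. *)
Lemma dominating_setC (G : sgraph) (S : {set G}) :
  dominating S && dominating (~: S) = weak_coloring S.
Proof.
apply/andP/weak_coloringP => [[/forallP dS /forallP dC] v | H].
  have [vS | vNS] := boolP (v \in S).
    have := dC v; rewrite inE vS /= => /existsP[u /andP[]]; rewrite inE => uS vu.
    by exists u; rewrite // (negbTE uS).
  have := dS v; rewrite vNS /= => /existsP[u /andP[uS vu]].
  by exists u; rewrite ?uS.
split; apply/forallP => v; apply/implyP; rewrite ?inE => vS;
  have [u vu uS] := H v; apply/existsP; exists u; rewrite vu ?inE andbT;
  by move: vS uS; case: (v \in S); case: (u \in S).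
Qed.

Lemma partition_setC (T : finType) (S : {set T}) :
  S != set0 -> ~: S != set0 -> partition [set S; ~: S] [set: T].
Proof.
move=> S0 C0; apply/and3P; split.
- by rewrite /cover bigcup_setU !big_set1 setUCr.
- apply/trivIsetP => A B; rewrite !inE => /orP[] /eqP-> /orP[] /eqP->;
    by rewrite ?eqxx // -setI_eq0 ?setICr // setIC setICr.
- by rewrite !inE negb_or eq_sym S0 eq_sym C0.
Qed.

Lemma partition2_setC (T : finType) (A B : {set T}) :
  A != B -> partition [set A; B] [set: T] -> B = ~: A.
Proof.
move=> AB /and3P[/eqP cov /trivIsetP tr _].
have dAB : [disjoint A & B] by apply: tr; rewrite ?inE ?eqxx ?orbT.
have U : A :|: B = setT by rewrite -cov /cover bigcup_setU !big_set1.
apply/setP => x; rewrite inE; have := in_setT x; rewrite -U inE.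
have [xA _ | //] := boolP (x \in A).
by rewrite (disjointFr dAB xA).
Qed.

(** Exactly one of the two blocks contains [r], so sending [S] to [[set S; ~: S]] is a bijection
    from the rooted sets to the partitions. *)
Lemma w2_rooted (G : sgraph) (r : G) :
  w2 G = #|[set S : {set G} | weak_coloring S && (r \in S)]|.
Proof.
pose f (S : {set G}) := [set S; ~: S].
rewrite -[RHS](@card_in_imset _ _ f); last first.
  move=> S S'; rewrite !inE => /andP[_ rS] /andP[_ rS'] /setP/(_ S).
  rewrite !inE eqxx /= => /esym/orP[/eqP // | /eqP E].
  by move: rS; rewrite E inE rS'.
rewrite /w2; apply: eq_card => P; rewrite inE; apply/idP/imsetP.
  case/and3P=> part /cards2P[A [B [AB defP]]] /forall_inP dom; subst P.
  have BA := partition2_setC AB part.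
  have wA : weak_coloring A.
    by rewrite -dominating_setC -BA !dom ?inE ?eqxx ?orbT.
  have [rA | rA] := boolP (r \in A).
    by exists A; rewrite /f ?inE ?wA // BA.
  exists B; rewrite /f BA ?setCK 1?setUC // !inE rA andbT.
  by rewrite -dominating_setC setCK andbC dominating_setC.
case=> S; rewrite inE => /andP[wS rS] ->.
(* The neighbour of [r] of the other colour shows that [~: S] is nonempty. *)
have [u ru uS] := weak_coloringP _ wS r.
have S0 : S != set0 by apply/set0Pn; exists r.
have C0 : ~: S != set0.
  by apply/set0Pn; exists u; move: uS; rewrite rS inE; case: (u \in S).
apply/and3P; split; first exact: partition_setC.
- rewrite cards2; case: (S =P ~: S) => // /setP/(_ r).
  by rewrite inE rS.
- move: wS; rewrite -dominating_setC => /andP[dS dC].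
  by apply/forall_inP => A; rewrite !inE => /orP[] /eqP->.
Qed.

Section Restriction.
Variables (G : sgraph) (D : {set G}).

Definition restrict (S : {set G}) : {set delete D} := [set v | val v \in S].

(** Phrases the condition on the subgraph within [G], so that colourings of both graphs can be
    compared without the subtype. *)
Lemma weak_coloring_restrictP (S : {set G}) :
  reflect (forall v, v \notin D ->
             exists u, [/\ u \notin D, adj v u & (u \in S) != (v \in S)])
          (weak_coloring (restrict S)).
Proof.
apply: (iffP (weak_coloringP _)) => H v.
  move=> vD; have [u vu] := H (Sub v vD); rewrite !inE => uS.
  by exists (val u); split=> //; exact: (valP u).
have [u [uD vu uS]] := H _ (valP v).
by exists (Sub u uD); rewrite ?inE.
Qed.

(** Once the trace on [D] is forced to be [E], a set is determined by its restriction, and any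
    restriction extends by adding [E]. Below, [D] consists of the deleted vertices and [E] records
    their forced colours. *)
Lemma card_restrict (E : {set G}) (P : pred {set G}) (Q : pred {set delete D}) :
  E \subset D -> (forall S, P S -> S :&: D = E) ->
  (forall S, S :&: D = E -> P S = Q (restrict S)) ->
  #|[set S | P S]| = #|[set S | Q S]|.
Proof.
move=> ED PE PQ; rewrite -(@card_in_imset _ _ restrict); last first.
  move=> S S'; rewrite !inE => /PE SE /PE S'E /setP eqS; apply/setP => x.
  have [xD | xD] := boolP (x \in D).
    by have /setP/(_ x) := etrans SE (esym S'E); rewrite !inE xD !andbT.
  by have := eqS (Sub x xD); rewrite !inE.
apply: eq_card => R; rewrite !inE; apply/imsetP/idP.
  by case=> S; rewrite inE => PS ->; rewrite -PQ ?PE.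
move=> QR; pose S := [set val v | v in R] :|: E.
have SE : S :&: D = E.
  rewrite setIUl (setIidPl ED); apply/setUidPr/subsetP => x /setIP[].
  by case/imsetP => v _ ->; rewrite (negbTE (valP v)).
have RS : R = restrict S.
  apply/setP => v; rewrite !inE mem_imset; last exact: val_inj.
  case: (boolP (val v \in E)) => [/(subsetP ED)|_]; last by rewrite orbF.
  by rewrite (negbTE (valP v)).
by exists S => //; rewrite inE PQ // -RS.
Qed.

End Restriction.

Section QuasiStar.
Variables (G : sgraph) (y z : G).
Hypothesis nbr_y : [set v | adj y v && ~~ leaf v] = [set z].
Hypothesis ones_neq0 : [exists v, adj y v && leaf v].

Let adj_yz : adj y z.
Proof. by have /setP/(_ z) := nbr_y; rewrite !inE eqxx => /andP[]. Qed.

Let z_nleaf : ~~ leaf z.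
Proof. by have /setP/(_ z) := nbr_y; rewrite !inE eqxx => /andP[]. Qed.

Let z_ones : z \notin ones y.
Proof. by rewrite inE negb_and z_nleaf orbT. Qed.

Let y_ones : y \notin ones y.
Proof. by rewrite inE adj_irr. Qed.

Let adj_y v : adj y v -> v \notin ones y -> v = z.
Proof.
move=> yv; rewrite inE yv => vN; have /setP/(_ v) := nbr_y.
by rewrite !inE yv vN => /esym/eqP.
Qed.

Let adj_ones v u : v \in ones y -> adj v u -> u = y.
Proof.
rewrite inE => /andP[yv /cards1P[w /setP W]] vu.
have := W y; rewrite !inE adj_sym yv => /esym/eqP->.
by have := W u; rewrite !inE vu => /esym/eqP.
Qed.

Let ones_color S v :
  weak_coloring S -> v \in ones y -> (v \in S) = (y \notin S).
Proof.
move=> /weak_coloringP/(_ v)[u vu uS] vL; move: uS.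
by rewrite (adj_ones vL vu); case: (v \in S); case: (y \in S).
Qed.

Lemma card_coloring_del1 :
  #|[set S | [&& weak_coloring S, z \in S & y \notin S]]| = w2 (del1 y).
Proof.
rewrite (@w2_rooted (del1 y) (Sub z z_ones)).
(* As [y] is outside [S], all its leaves are forced into [S]. *)
apply: (@card_restrict _ (ones y) (ones y)) => // S.
  case/and3P=> wS zS yS; apply/setP => v; rewrite [LHS]inE.
  by case: (boolP (v \in ones y)) => [/(ones_color wS)->|]; rewrite ?yS ?andbF.
move=> /setP LS; rewrite [_ \in restrict _ _]inE /=.
have leafS v : v \in ones y -> v \in S.
  by move=> vL; have := LS v; rewrite inE vL andbT.
apply/and3P/andP => [[/weak_coloringP wS zS yS] | [wS zS]].
  split=> //; apply/weak_coloring_restrictP => v vL; have [u vu uS] := wS v.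
  have [uL | uL] := boolP (u \in ones y); last by exists u.
  (* Only [y] can lose a differing neighbour by the deletion, and [z] replaces it. *)
  have -> : v = y by apply: (adj_ones uL); rewrite adj_sym.
  by exists z; split=> //; rewrite zS (negbTE yS).
(* In [del1 y] the only neighbour of [y] is [z], which forces the colour of [y]. *)
have yS : y \notin S.
  have [u [uL yu uS]] := weak_coloring_restrictP _ _ wS y y_ones.
  by move: uS; rewrite (adj_y yu uL) zS; case: (y \in S).
split=> //; apply/weak_coloringP => v.
have [vL | vL] := boolP (v \in ones y).
  exists y; last by rewrite (leafS v vL) (negbTE yS).
  by move: vL; rewrite inE adj_sym => /andP[].
by have [u [_ vu uS]] := weak_coloring_restrictP _ _ wS v vL; exists u.
Qed.

Lemma card_coloring_del2 :
  #|[set S | [&& weak_coloring S, z \in S & y \in S]]| = w2 (del2 y).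
Proof.
have zD : z \notin ones y :|: [set y].
  rewrite in_setU in_set1 negb_or z_ones /=.
  by apply: contraTneq adj_yz => ->; rewrite adj_irr.
rewrite (@w2_rooted (del2 y) (Sub z zD)).
(* Of the deleted vertices [y] is in [S] and its leaves are not. *)
apply: (@card_restrict _ (ones y :|: [set y]) [set y]) => [|S|S].
- exact: subsetUr.
- case/and3P=> wS zS yS; apply/setP => v.
  rewrite in_setI in_setU in_set1; have [-> | _] := eqVneq v y.
    by rewrite yS orbT.
  rewrite orbF; case: (boolP (v \in ones y)) => [/(ones_color wS)->|].
    by rewrite yS.
  by rewrite andbF.
move=> /setP LS; rewrite [_ \in restrict _ _]inE /=.
have yS : y \in S.
  by have := LS y; rewrite in_setI in_setU !in_set1 eqxx orbT andbT.
have leafS v : v \in ones y -> v \notin S.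
  move=> vL; have := LS v; rewrite in_setI in_setU !in_set1 vL /= andbT => ->.
  by apply: contraNneq y_ones => vy; rewrite -{1}vy.
rewrite yS andbT; apply: andb_id2r => zS.
apply/weak_coloringP/weak_coloring_restrictP => wS v.
  rewrite in_setU in_set1 negb_or => /andP[vL vy]; have [u vu uS] := wS v.
  exists u; split=> //; rewrite in_setU in_set1 negb_or; apply/andP; split.
    apply: contraNN vy => uL; apply/eqP; apply: (adj_ones uL).
    by rewrite adj_sym.
  (* The only surviving neighbour of [y] is [z], which has the colour of [y], so no surviving vertex
     relied on [y]. *)
  apply: contraNneq uS => uy; move: vu; rewrite uy adj_sym => yv.
  by rewrite (adj_y yv vL) yS zS.
have [vL | vL] := boolP (v \in ones y).
  exists y; last by rewrite yS (negbTE (leafS v vL)).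
  by move: vL; rewrite inE adj_sym => /andP[].
(* Since [z] agrees with [y], a leaf has to serve [y]. *)
have [-> | vy] := eqVneq v y.
  have /existsP[l yl] := ones_neq0; exists l; first by case/andP: yl.
  by rewrite yS (negbTE (leafS l _)) // inE.
have [|u [_ vu uS]] := wS v; first by rewrite !in_setU !in_set1 negb_or vL.
by exists u.
Qed.

Lemma w2_quasi_star : w2 G = w2 (del1 y) + w2 (del2 y).
Proof.
rewrite (w2_rooted z) -card_coloring_del1 -card_coloring_del2 addnC.
rewrite -(cardsID [set S : {set G} | y \in S]).
congr (_ + _); apply: eq_card => S; rewrite !inE; first by rewrite andbA.
by rewrite andbC andbA.
Qed.

End QuasiStar.

(** With the root at the centre, every other vertex must differ from its only neighbour, the centre,
    which leaves only [[set c]]; [r_gt0] supplies a neighbour to serve the centre. *)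
Lemma w2_star r : 0 < r -> w2 (complete_bipartite 1 r) = 1.
Proof.
move=> r_gt0; pose c : complete_bipartite 1 r := inl ord0.
rewrite (w2_rooted c); apply: (etrans _ (cards1 [set c])); apply: eq_card => S.
rewrite !inE; apply/andP/eqP => [[/weak_coloringP wS cS] | ->].
  apply/setP => -[i | j]; rewrite inE; first by rewrite [i]ord1 eqxx.
  have [[i | //] _] := wS (inr j).
  by rewrite [i]ord1 cS; case: (inr j \in S).
split; last exact: set11.
apply/weak_coloringP => -[i | j].
  by exists (inr (Ordinal r_gt0)) => //; rewrite !inE [i]ord1 eqxx.
by exists c => //; rewrite !inE eqxx.
Qed.

Theorem mainTheorem4 :
  (forall (T : sgraph) (y : T),
     tree T -> 4 <= #|T| -> quasi_star y ->
     w2 T = w2 (del1 y) + w2 (del2 y))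
  /\ (forall r : nat, 1 <= r -> w2 (complete_bipartite 1 r) = 1).
Proof.
split=> [T y _ _ /andP[/cards1P[z nbr_y] leaf_y] | r]; last exact: w2_star.
exact: w2_quasi_star nbr_y leaf_y.
Qed.
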